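(* Let $F$ be a linear forest without isolated vertices. Then for all sufficiently large $n$, every minimum $(K_1\vee F)$-saturated graph $G$ on $n$ vertices satisfies $e(G)=(n-1)+\mathrm{sat}(n-1,F)$, and $$\mathrm{Sat}(n,K_1\vee F)=\{K_1\vee H:\ H \text{ is a minimum } F\text{-saturated graph on } n-1 \text{ vertices}\}.$$
   Context: All graphs are finite and simple. A linear forest is a vertex-disjoint union of paths; ''without isolated vertices'' means each path has at least two vertices. $K_1\vee F$ denotes the join of a single vertex with $F$ (the vertex is made adjacent to all vertices of $F$). A graph $G$ is $F$-saturated if $G$ contains no subgraph isomorphic to $F$, but for every pair of nonadjacent vertices $u,v$ of $G$, $G+uv$ contains a subgraph isomorphic to $F$. $\mathrm{sat}(n,F)$ is the minimum number of edges of an $F$-saturated graph on $n$ vertices, a minimum $F$-saturated graph is one attaining this, and $\mathrm{Sat}(n,F)$ is the set of all $F$-saturated graphs on $n$ vertices with $\mathrm{sat}(n,F)$ edges. *)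

(* Defs.v *)
From HB Require Import structures.
From mathcomp Require Import all_boot.

Set Implicit Arguments.
Unset Strict Implicit.
Unset Printing Implicit Defensive.

(* A finite simple graph on the vertex type T, given by its set of edges,
   an edge being a two-element set of vertices. *)
Record sgraph (T : finType) := SGraph {
  edges : {set {set T}};
  _ : [forall A in edges, #|A| == 2] }.

HB.instance Definition _ (T : finType) := [isSub for @edges T].
HB.instance Definition _ (T : finType) := [Finite of sgraph T by <:].

Definition adj (T : finType) (G : sgraph T) : rel T :=
  fun x y => [set x; y] \in edges G.

(* The graph in which distinct x and y are adjacent iff r x y or r y x. *)
Definition edges_of (T : finType) (r : rel T) : {set {set T}} :=
  [set [set p.1; p.2] | p : T * T & (p.1 != p.2) && r p.1 p.2].

Lemma edges_ofP (T : finType) (r : rel T) :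
  [forall A in edges_of r, #|A| == 2].
Proof.
apply/forall_inP => A /imsetP[p]; rewrite inE => /andP[np _] ->.
by rewrite cards2 np.
Qed.

Definition graph_of (T : finType) (r : rel T) : sgraph T :=
  SGraph (edges_ofP r).

Definition complete (T : finType) : sgraph T := graph_of (fun _ _ : T => true).

Notation "''K_' n" := (complete 'I_n)
  (at level 8, n at level 2, format "''K_' n").

Definition path_graph (k : nat) : sgraph 'I_k :=
  graph_of (fun i j : 'I_k => i.+1 == j).

Definition join (T U : finType) (G : sgraph T) (H : sgraph U) :
    sgraph (T + U)%type :=
  graph_of (fun u v : T + U => match u, v with
    | inl x, inl y => adj G x y
    | inr x, inr y => adj H x y
    | _, _ => true
    end).

Definition disjoint_union (I : finType) (T : I -> finType)
    (G : forall i, sgraph (T i)) : sgraph {i : I & T i} :=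
  graph_of (fun u v : {i : I & T i} =>
    (tag u == tag v) && adj (G (tag u)) (tagged u) (tagged_as u v)).

Definition add_edge (T : finType) (G : sgraph T) (u v : T) : sgraph T :=
  graph_of (fun x y => adj G x y || (x == u) && (y == v)).

Definition isomorphic (T U : finType) (G : sgraph T) (H : sgraph U) : bool :=
  [exists f : {ffun T -> U},
    [&& injectiveb f, [forall y, y \in codom f]
      & [forall x, forall y, adj G x y == adj H (f x) (f y)]]].

(* G contains a (not necessarily induced) subgraph isomorphic to F. *)
Definition contains (U T : finType) (F : sgraph U) (G : sgraph T) : bool :=
  [exists f : {ffun U -> T}, injectiveb f &&
    [forall x, forall y, adj F x y ==> adj G (f x) (f y)]].

Definition saturated (U T : finType) (F : sgraph U) (G : sgraph T) : bool :=
  ~~ contains F G &&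
  [forall u, forall v,
    (u != v) && ~~ adj G u v ==> contains F (add_edge G u v)].

(* The initial value 'C(n, 2) bounds the number of edges of every graph on n
   vertices, so it only matters when there is no F-saturated graph on n
   vertices. *)
Definition sat (n : nat) (U : finType) (F : sgraph U) : nat :=
  \big[minn/'C(n, 2)]_(G : sgraph 'I_n | saturated F G) #|edges G|.

(* The minimum F-saturated graphs on n vertices, as labelled graphs on 'I_n. *)
Definition Sat (n : nat) (U : finType) (F : sgraph U) : {set sgraph 'I_n} :=
  [set G | saturated F G && (#|edges G| == sat n F)].

Definition path_forest (s : seq nat) :=
  disjoint_union (fun i : 'I_(size s) => path_graph (nth 0 s i)).

(* A linear forest without isolated vertices; s lists the numbers of vertices
   of its paths. *)
Definition linear_forest_no_isolated (U : finType) (F : sgraph U) : Prop :=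
  exists2 s : seq nat, all (leq 2) s & isomorphic F (path_forest s).

(* Main.v *)
(* In a saturated graph G for the cone K_1 v F, two nonadjacent vertices have a
   common neighbour, because every edge of the cone lies in a triangle. A graph
   on n vertices with this property and no dominating vertex has at least 2n-5
   edges. On the other hand, for large m there are F-saturated graphs with at
   most m-4 edges: a clique on |F|-1 vertices, together with a forest with many
   components which is saturated for the shortest path of F. The cone over such
   a graph has less than 2n-5 edges, so a minimum G has a dominating vertex and
   is itself a cone, and the cone over H is saturated if and only if H is
   F-saturated. *)
Require Import Defs.
From mathcomp Require Import all_boot perm zify.

Set Implicit Arguments.
Unset Strict Implicit.
Unset Printing Implicit Defensive.

(** * Graphs and saturation numbers *)

(** With m = n - 1 the margin is exactly one edge: a cone over at most m - 4 edges has at most 2m -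
    4 edges, against the lower bound 2n - 5 = 2m - 3. The clique holds all of F but one vertex, so
    one new edge leaving it completes a copy of F; the shortest path is the right one to forbid in
    the forest because then no component of F fits there. The clique costs a number of edges
    depending on F only, which the forest must win back by its number of components, and it must do
    so for every large order. Joining two of its components has to create a long path, so the trees
    are grown in layers: three new leaves on every vertex of the last layer make the longest path
    longer by two vertices. The growth starts from isolated vertices or from single edges, according
    to parity, and surplus leaves on one vertex of the last layer adjust the order. *)

Lemma adj_sym (T : finType) (G : sgraph T) : symmetric (adj G).
Proof. by move=> x y; rewrite /adj setUC. Qed.

Lemma adj_irr (T : finType) (G : sgraph T) : irreflexive (adj G).
Proof.
move=> x; apply/negP; case: G => E hE; rewrite /adj /= => xE.
by move/forall_inP: hE => /(_ _ xE); rewrite cards2 eqxx.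
Qed.

Lemma adj_neq (T : finType) (G : sgraph T) x y : adj G x y -> x != y.
Proof. by apply: contraTneq => ->; rewrite adj_irr. Qed.

Lemma set2_eq (T : finType) (x y a b : T) : [set x; y] = [set a; b] ->
  (x = a /\ y = b) \/ (x = b /\ y = a).
Proof.
move=> E.
have [Hx Hy] : x \in [set a; b] /\ y \in [set a; b] by rewrite -E set21 set22.
have [Ha Hb] : a \in [set x; y] /\ b \in [set x; y] by rewrite E set21 set22.
move: Hx Hy Ha Hb; rewrite !inE.
by do 4!(case/orP => /eqP ?); subst; auto.
Qed.

Lemma adj_graph_of (T : finType) (r : rel T) x y :
  adj (graph_of r) x y = (x != y) && (r x y || r y x).
Proof.
apply/imsetP/idP => [[[a b]] | /andP[nxy /orP[rxy|ryx]]].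
- rewrite inE /= => /andP[nab rab] /set2_eq[] [-> ->]; rewrite rab ?orbT ?andbT //.
  by rewrite eq_sym.
- by exists (x, y); rewrite ?inE /= ?nxy.
- by exists (y, x); rewrite ?inE /= 1?eq_sym ?nxy // setUC.
Qed.

Lemma adj_add_edge (T : finType) (G : sgraph T) u v x y :
  adj (add_edge G u v) x y =
  (x != y) && [|| adj G x y, (x == u) && (y == v) | (x == v) && (y == u)].
Proof.
rewrite adj_graph_of (adj_sym G y x); case: (x != y) => //=.
by case: (adj G x y) => //=; rewrite (andbC (y == u)).
Qed.

Lemma sum_nat_bool (I : finType) (P : pred I) : \sum_i P i = #|[set i | P i]|.
Proof. by rewrite -sum1dep_card [RHS]big_mkcond; apply: eq_bigr => i _; case: (P i). Qed.

Lemma card_edge (T : finType) (G : sgraph T) A : A \in edges G -> #|A| = 2.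
Proof. by case: G => E hE /= /(forall_inP hE)/eqP. Qed.

Lemma handshake (T : finType) (G : sgraph T) :
  \sum_x \sum_y adj G x y = 2 * #|edges G|.
Proof.
have deg x : \sum_y adj G x y = \sum_(A in edges G) (x \in A).
  transitivity (\sum_(A : {set T}) ((A \in edges G) && (x \in A))); last first.
    by rewrite [RHS]big_mkcond; apply: eq_bigr => A _; case: ifP.
  rewrite !sum_nat_bool -(card_in_imset (f := fun y => [set x; y])); last first.
    move=> y z; rewrite !inE => /adj_neq nxy _ /set2_eq[[_ //]|[exz eyx]].
    by rewrite eyx eqxx in nxy.
  congr #|pred_of_set _|; apply/setP => A; rewrite inE; apply/imsetP/andP.
    by case=> y; rewrite inE => xy ->; rewrite set21.
  case=> AE xA; have /eqP/cards2P[a [b [nab eA]]] := card_edge AE.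
  move: xA AE; rewrite eA !inE => /orP[] /eqP -> AE; [exists b | exists a]; rewrite ?inE //.
    by rewrite /adj setUC.
  by rewrite setUC.
under eq_bigr do rewrite deg.
rewrite exchange_big /= mulnC -sum_nat_const; apply: eq_bigr => A AE.
by rewrite sum_nat_bool -(card_edge AE); apply: eq_card => x; rewrite inE.
Qed.

Lemma card_edges_graph_of (T : finType) (r : rel T) :
  #|edges (graph_of r)| <= \sum_x \sum_y r x y.
Proof.
apply: leq_trans (leq_imset_card _ _) _.
rewrite pair_big /= (eq_bigr (fun p : T * T => nat_of_bool (r p.1 p.2))) //.
rewrite sum_nat_bool -cardsE; apply: subset_leq_card.
by apply/subsetP => p; rewrite !inE => /andP[].
Qed.

Section Iso.
Variables (T T' : finType) (G : sgraph T) (G' : sgraph T').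

Lemma isomorphicP : reflect
  (exists f g, [/\ cancel f g, cancel g f & forall x y, adj G x y = adj G' (f x) (f y)])
  (isomorphic G G').
Proof.
apply: (iffP existsP) => [[f /and3P[/injectiveP fI /forallP fS /forallP fA]]|];
  last case=> f [g [fK gK fA]].
  exists f; exists (fun y => iinv (fS y)); split => [x|y|x y].
  - by apply: fI; rewrite f_iinv.
  - by rewrite f_iinv.
  - by apply/eqP; move/forallP: (fA x).
exists [ffun x => f x]; apply/and3P; split.
- by apply/injectiveP => x y; rewrite !ffunE => /(can_inj fK).
- by apply/forallP => y; apply/codomP; exists (g y); rewrite ffunE gK.
- by apply/forallP => x; apply/forallP => y; rewrite !ffunE fA.
Qed.

End Iso.

Lemma isomorphic_sym (T T' : finType) (G : sgraph T) (G' : sgraph T') :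
  isomorphic G G' -> isomorphic G' G.
Proof.
case/isomorphicP => f [g [fK gK fA]]; apply/isomorphicP; exists g, f; split => // x y.
by rewrite fA !gK.
Qed.

Lemma containsP (U T : finType) (F : sgraph U) (G : sgraph T) : reflect
  (exists2 f : U -> T, injective f & forall x y, adj F x y -> adj G (f x) (f y))
  (contains F G).
Proof.
apply: (iffP existsP) => [[f /andP[/injectiveP fI /forallP fA]] | [f fI fA]].
  by exists f => // x y; apply/implyP; move/forallP: (fA x).
exists [ffun x => f x]; apply/andP; split.
  by apply/injectiveP => x y; rewrite !ffunE => /fI.
by apply/forallP => x; apply/forallP => y; rewrite !ffunE; apply/implyP/fA.
Qed.

Lemma saturatedP (U T : finType) (F : sgraph U) (G : sgraph T) : reflect
  (~~ contains F G /\
   forall u v, u != v -> ~~ adj G u v -> contains F (add_edge G u v))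
  (saturated F G).
Proof.
apply: (iffP andP) => -[nF sF]; split => //.
  by move=> u v nuv auv; move/forallP: sF => /(_ u)/forallP/(_ v)/implyP; apply; apply/andP.
by apply/forallP => u; apply/forallP => v; apply/implyP => /andP[]; apply: sF.
Qed.

Lemma contains_isol (U U' T : finType) (F : sgraph U) (F' : sgraph U') (G : sgraph T) :
  isomorphic F F' -> contains F G = contains F' G.
Proof.
have imp (V V' : finType) (E : sgraph V) (E' : sgraph V') :
    isomorphic E E' -> contains E G -> contains E' G.
  case/isomorphicP => f [g [fK gK fA]] /containsP[h hI hA]; apply/containsP.
  exists (h \o g); first exact: inj_comp hI (can_inj gK).
  by move=> x y xy; apply: hA; rewrite fA !gK.
by move=> i; apply/idP/idP; apply: imp => //; apply: isomorphic_sym.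
Qed.

Lemma saturated_isol (U U' T : finType) (F : sgraph U) (F' : sgraph U') (G : sgraph T) :
  isomorphic F F' -> saturated F G = saturated F' G.
Proof.
move=> i; rewrite /saturated (contains_isol _ i); congr (_ && _).
by apply: eq_forallb => u; apply: eq_forallb => v; rewrite (contains_isol _ i).
Qed.

Lemma contains_isor (U T T' : finType) (F : sgraph U) (G : sgraph T) (G' : sgraph T') :
  isomorphic G G' -> contains F G -> contains F G'.
Proof.
case/isomorphicP => f [g [fK gK fA]] /containsP[h hI hA]; apply/containsP.
exists (f \o h); first exact: inj_comp (can_inj fK) hI.
by move=> x y /hA; rewrite fA.
Qed.

Lemma saturated_isor (U T T' : finType) (F : sgraph U) (G : sgraph T) (G' : sgraph T') :
  isomorphic G G' -> saturated F G -> saturated F G'.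
Proof.
move=> i /saturatedP[nF sF]; apply/saturatedP; split.
  by apply: contra nF; apply: contains_isor; apply: isomorphic_sym.
case/isomorphicP: i => f [g [fK gK fA]] u v nuv auv.
have : contains F (add_edge G (g u) (g v)).
  by apply: sF; rewrite ?(can_eq gK) // fA !gK.
apply: contains_isor; apply/isomorphicP; exists f, g; split => // x y.
by rewrite !adj_add_edge fA (can_eq fK) !(can2_eq fK gK).
Qed.

Lemma card_edges_iso (T T' : finType) (G : sgraph T) (G' : sgraph T') :
  isomorphic G G' -> #|edges G| = #|edges G'|.
Proof.
case/isomorphicP => f [g [fK gK fA]].
suff: 2 * #|edges G| = 2 * #|edges G'| by lia.
rewrite -!handshake [RHS](reindex f) /=; last by exists g => x _.
apply: eq_bigr => x _; rewrite [RHS](reindex f) /=; last by exists g => y _.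
by apply: eq_bigr => y _; rewrite fA.
Qed.

Lemma card_edges_le (T : finType) (G : sgraph T) : #|edges G| <= 'C(#|T|, 2).
Proof.
rewrite -card_draws; apply: subset_leq_card; apply/subsetP => A AE.
by rewrite inE (card_edge AE).
Qed.

Lemma sat_le n (U : finType) (F : sgraph U) (G : sgraph 'I_n) :
  saturated F G -> sat n F <= #|edges G|.
Proof.
move=> sG; rewrite /sat; have := mem_index_enum G.
elim: (index_enum _) => //= H r IH; rewrite inE big_cons => /orP[/eqP <-|/IH le].
  by rewrite sG geq_minl.
by case: ifP => // _; apply: leq_trans (geq_minr _ _) le.
Qed.

Lemma sat_attained n (U : finType) (F : sgraph U) (G : sgraph 'I_n) :
  saturated F G -> exists2 H : sgraph 'I_n, saturated F H & #|edges H| = sat n F.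
Proof.
move=> sG; have [Cn | //] : sat n F = 'C(n, 2) \/
    exists2 H : sgraph 'I_n, saturated F H & #|edges H| = sat n F.
  rewrite /sat; apply: (big_ind (fun v => v = 'C(n, 2) \/
    exists2 H : sgraph 'I_n, saturated F H & #|edges H| = v)); first by left.
    by move=> x y hx hy; rewrite /minn; case: ifP.
  by move=> H sH; right; exists H.
(* The minimum is the default value, which bounds the size of every graph, so [G] itself attains
   it. *)
exists G => //; apply/eqP; rewrite eqn_leq sat_le // Cn andbT.
by rewrite -[n in 'C(n, 2)]card_ord card_edges_le.
Qed.

Lemma SatP n (U : finType) (F : sgraph U) (G : sgraph 'I_n) : reflect
  (saturated F G /\ forall H : sgraph 'I_n, saturated F H -> #|edges G| <= #|edges H|)
  (G \in Sat n F).
Proof.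
rewrite inE; apply: (iffP andP) => [[sG /eqP ->] | [sG minG]].
  by split=> // H; apply: sat_le.
split=> //; have [H sH eH] := sat_attained sG.
have le1 := sat_le sG; have := minG _ sH; rewrite eH => le2; apply/eqP; lia.
Qed.

(** * Cones *)

Lemma adj_join (T U : finType) (G : sgraph T) (H : sgraph U) u v :
  adj (join G H) u v = match u, v with
    | inl x, inl y => adj G x y
    | inr x, inr y => adj H x y
    | _, _ => true
    end.
Proof.
rewrite adj_graph_of; case: u v => [x|x] [y|y] //=; rewrite adj_sym orbb.
  by apply: andb_idl => /adj_neq; rewrite eq_sym.
by apply: andb_idl => /adj_neq; rewrite eq_sym.
Qed.

Lemma adj_K1 x y : adj 'K_1 x y = false.
Proof. by rewrite !ord1 adj_irr. Qed.

Notation apex := (@inl 'I_1 _ ord0).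

Section Cone.
Variables (U T : finType) (F : sgraph U).
Implicit Types H : sgraph T.

Notation cone X := (join 'K_1 X).

Lemma contains_cone H : contains (cone F) (cone H) = contains F H.
Proof.
apply/containsP/containsP => [[f fI fA] | [f fI fA]]; last first.
  exists (fun u => match u with inl x => inl x | inr x => inr (f x) end).
    by move=> [x|x] [y|y] // [] => [->|/fI ->].
  by move=> [x|x] [y|y]; rewrite !adj_join //; apply: fA.
have fA' x y : adj F x y -> adj (cone H) (f (inr x)) (f (inr y)).
  by move=> xy; apply: fA; rewrite adj_join.
case E: (f apex) => [c|h].
  (* The apex goes to the apex, so injectivity keeps the image of [F] in the base. *)
  have nl x : {y | f (inr x) = inr y}.
    case Ex: (f (inr x)) => [d|y]; last by exists y.
    by have := fI (inr x) apex; rewrite Ex E !ord1 => /(_ erefl).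
  exists (fun x => sval (nl x)) => [x y exy | x y /fA'].
    have := svalP (nl x); rewrite exy -(svalP (nl y)) => /fI[] //.
  by case: (nl x) (nl y) => [a /= ->] [b /= ->]; rewrite adj_join.
(* The centre of the cone over F sits at h : T; the vertex of F sent to the
   apex of the cone over H, if any, can be moved to h. *)
pose g x := if f (inr x) is inr y then y else h.
have gN x : adj (cone H) (inr h) (f (inr x)) by rewrite -E; apply: fA; rewrite adj_join.
have nh x : f (inr x) != inr h.
  by rewrite -E; apply/eqP => /fI.
exists g => [x y | x y xy].
  rewrite /g; case Ex: (f (inr x)) => [c|a]; case Ey: (f (inr y)) => [d|b] => //.
  - by have := fI (inr x) (inr y); rewrite Ex Ey !ord1 => /(_ erefl)[].
  - by move=> e; have := nh y; rewrite Ey e eqxx.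
  - by move=> e; have := nh x; rewrite Ex e eqxx.
  - by move=> e; have := fI (inr x) (inr y); rewrite Ex Ey e => /(_ erefl)[].
have := fA' _ _ xy; have := gN x; have := gN y; rewrite /g.
case: (f (inr x)) => [c|a]; case: (f (inr y)) => [d|b]; rewrite !adj_join //.
  by rewrite adj_K1.
by rewrite adj_sym.
Qed.

Lemma cone_add_edge H u v :
  isomorphic (add_edge (cone H) (inr u) (inr v)) (cone (add_edge H u v)).
Proof.
apply/isomorphicP; exists id, id; split => // x y.
rewrite adj_add_edge !adj_join; case: x y => [x|x] [y|y] //=.
  by rewrite orbF adj_K1 andbF.
by rewrite adj_add_edge.
Qed.

End Cone.

(** Two nonadjacent vertices of a cone lie in its base, and adding an edge there commutes with
    coning. *)
Lemma saturated_cone (U T : finType) (F : sgraph U) (H : sgraph T) :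
  saturated (join 'K_1 F) (join 'K_1 H) = saturated F H.
Proof.
apply/saturatedP/saturatedP => -[nF sF].
  rewrite contains_cone in nF; split => // u v nuv auv.
  rewrite -contains_cone; apply: contains_isor (cone_add_edge _ _ _) _.
  by apply: sF; rewrite ?adj_join.
rewrite contains_cone; split => // -[x|x] [y|y]; rewrite ?adj_join //.
  by rewrite !ord1 eqxx.
move=> nxy axy; apply: contains_isor (isomorphic_sym (cone_add_edge _ _ _)) _.
by rewrite contains_cone; apply: sF.
Qed.

Lemma card_edges_cone (T : finType) (H : sgraph T) :
  #|edges (join 'K_1 H)| = #|T| + #|edges H|.
Proof.
suff: 2 * #|edges (join 'K_1 H)| = 2 * (#|T| + #|edges H|) by lia.
rewrite mulnDr -!handshake big_sumType big_ord1 !big_sumType big_ord1 adj_irr /=.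
under eq_bigr do rewrite adj_join.
under [X in _ + X]eq_bigr => x _.
  rewrite big_sumType big_ord1 adj_join /=.
  under eq_bigr do rewrite adj_join.
  over.
by rewrite big_split /= !sum1_card add0n addnA addnn -mul2n.
Qed.

Lemma dominating_cone n (G : sgraph 'I_n) v :
  (forall w, w != v -> adj G v w) ->
  exists H : sgraph 'I_n.-1, isomorphic G (join 'K_1 H).
Proof.
case: n G v => [G []// | m] G v dom /=.
exists (graph_of (fun i j => adj G (lift v i) (lift v j))).
apply/isomorphicP.
exists (fun x => if unlift v x is Some i then inr i else apex).
exists (fun u => match u with inl _ => v | inr i => lift v i end).
split => [x|[x|x]|x y].
- by case: unliftP.
- by rewrite unlift_none !ord1.
- by rewrite liftK.
rewrite adj_join; case: unliftP => [i ->|->]; case: unliftP => [j ->|->].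
- rewrite adj_graph_of (adj_sym _ (lift v j)) orbb; symmetry; apply: andb_idl => /adj_neq.
  by rewrite (inj_eq lift_inj).
- by rewrite adj_sym dom // eq_sym neq_lift.
- by rewrite dom // eq_sym neq_lift.
- by rewrite adj_K1 adj_irr.
Qed.

Lemma cone_saturated_diam2 (U T : finType) (F : sgraph U) (G : sgraph T) :
  (forall a, exists b, adj F a b) -> saturated (join 'K_1 F) G ->
  forall u v, u != v -> ~~ adj G u v -> exists2 w, adj G u w & adj G v w.
Proof.
move=> noiso /saturatedP[nF sF] u v nuv auv.
have /containsP[f fI fA] := sF u v nuv auv.
(* Some edge of the cone must be sent to the new edge [uv], since otherwise [G] would already
   contain the cone. *)
case: (boolP [exists p, adj (join 'K_1 F) p.1 p.2 && ~~ adj G (f p.1) (f p.2)]); last first.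
  move=> /existsPn H; case/containsP: nF; exists f => // x y xy.
  by have := H (x, y); rewrite /= xy negbK.
case/existsP => -[x y] /= /andP[xy nxy].
(* The third vertex of a triangle on [xy]; by injectivity its other two sides avoid the new edge. *)
have [z xz yz] : exists2 z, adj (join 'K_1 F) x z & adj (join 'K_1 F) y z.
  case: x y xy {nxy} => [x|x] [y|y]; rewrite adj_join.
  - by rewrite adj_K1.
  - by move=> _; have [z yz] := noiso y; exists (inr z); rewrite adj_join.
  - by move=> _; have [z yz] := noiso x; exists (inr z); rewrite adj_join.
  - by move=> _; exists apex; rewrite adj_join.
have := fA _ _ xz; have := fA _ _ yz; have := fA _ _ xy.
rewrite !adj_add_edge (negPf nxy) /=.
rewrite !(inj_eq fI) => /andP[_ e] /andP[nyz yz'] /andP[nxz xz'].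
have [[ex ey]|[ex ey]] : (f x = u /\ f y = v) \/ (f x = v /\ f y = u).
- by case/orP: e => /andP[/eqP -> /eqP ->]; auto.
- by rewrite -ex -ey; exists (f z); [move: xz' | move: yz'];
    rewrite -ex -ey !(inj_eq fI) !(eq_sym z) (negPf nyz) (negPf nxz) !andbF !orbF.
- by rewrite -ex -ey; exists (f z); [move: yz' | move: xz'];
    rewrite -ex -ey !(inj_eq fI) !(eq_sym z) (negPf nyz) (negPf nxz) !andbF !orbF.
Qed.

(** * Graphs of diameter two *)

(* Grow a set around r one vertex at a time, gaining two arcs each time. *)
Lemma connect_sum_ge (T : finType) (e : rel T) (r : T) (S : {set T}) :
  symmetric e -> (forall x, x \in S -> connect e r x) ->
  2 * #|S| <= \sum_x \sum_y e x y + 2.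
Proof.
move=> eS cS.
pose inn (X : {set T}) := \sum_(x in X) \sum_(y in X) e x y.
pose good (X : {set T}) := (r \in X) && (2 * #|X| <= inn X + 2).
have g1 : good [set r] by rewrite /good set11 cards1 /=; lia.
(* A largest good set is closed under [e], as a vertex joined to it could be added; hence it
   contains the whole component of [r]. *)
have [X /andP[rX leX] maxX] := arg_maxnP (fun X : {set T} => #|X|) g1.
have sSX : S \subset X.
  apply/subsetP => s /cS; apply: contraTT => sX; apply/negP => /(@closed_connect _ e).
  move=> /(_ (mem X)) H; suff cl : closed e (mem X) by rewrite -(H cl) rX in sX.
  apply: intro_closed; first exact: sym_connect_sym.
  move=> x y exy xX; apply: contraLR (isT) => yX.
  have /maxX : good (y |: X).
    rewrite /good inE rX orbT cardsU1 yX /=.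
    rewrite /inn big_setU1 //= big_setU1 //=.
    have -> : \sum_(i in X) \sum_(j in y |: X) e i j =
       \sum_(i in X) e i y + inn X.
      by rewrite -big_split; apply: eq_bigr => i _; rewrite big_setU1.
    have le1 : 1 <= \sum_(i in X) e i y.
      by rewrite (bigD1 x) //= exy.
    have le2 : 1 <= \sum_(i in X) e y i.
      by rewrite (bigD1 x) //= eS exy.
    lia.
  by rewrite cardsU1 yX; lia.
have := subset_leq_card sSX.
suff : inn X <= \sum_x \sum_y e x y by lia.
rewrite /inn [leqRHS](bigID (mem X)) /=; apply: leq_trans (leq_addr _ _).
by apply: leq_sum => x _; rewrite [leqRHS](bigID (mem X)) /= leq_addr.
Qed.

Section DiameterTwo.
Variables (T : finType) (G : sgraph T).
Hypothesis diam2 : forall u v, u != v -> ~~ adj G u v ->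
  exists2 w, adj G u w & adj G v w.
Hypothesis nodom : forall v, exists2 w, w != v & ~~ adj G v w.

Notation deg x := (\sum_y adj G x y).

(** * A vertex v whose neighbours are exactly a and b *)

Section DegreeTwo.
Variables v a b : T.
Hypotheses (nab : a != b) (NvE : forall y, adj G v y = (y == a) || (y == b)).

Let W w := [&& w != v, w != a & w != b].

Let va : adj G v a. Proof. by rewrite NvE eqxx. Qed.
Let vb : adj G v b. Proof. by rewrite NvE eqxx orbT. Qed.

Let W_adj w : W w -> adj G w a || adj G w b.
Proof.
case/and3P => wv wa wb.
have [|z] := diam2 wv; first by rewrite adj_sym NvE negb_or wa.
by move=> wz; rewrite NvE => /orP[]/eqP <-; rewrite wz ?orbT.
Qed.

Lemma sum_split3 (f : T -> nat) :
  \sum_x f x = f v + f a + f b + \sum_(w | W w) f w.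
Proof.
have nva := adj_neq va; have nvb := adj_neq vb.
rewrite (bigD1 v) //= (bigD1 a) 1?eq_sym //= (bigD1 b) /=; last first.
  by rewrite eq_sym nvb eq_sym nab.
by rewrite !addnA; congr (_ + _); apply: eq_bigl => x; rewrite /W andbA.
Qed.

Let s c := \sum_(w | W w) adj G w c.
Let E := \sum_(w | W w) \sum_(z | W z) adj G w z.

Let s_sym c : \sum_(w | W w) adj G c w = s c.
Proof. by apply: eq_bigr => w _; rewrite adj_sym. Qed.

(** Four arcs at [v], the arcs between [W] and [a], [b] in both directions, and the arcs inside [W];
    only a possible edge [ab] is left out. *)
Lemma sum_degree_ge : 4 + 2 * s a + 2 * s b + E <= \sum_x deg x.
Proof.
rewrite sum_split3 !(sum_split3 (fun y => nat_of_bool (adj G _ y))).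
under [X in _ <= _ + X]eq_bigr do rewrite sum_split3.
rewrite !big_split /= !s_sym -/E -/(s a) -/(s b).
rewrite (adj_sym _ a v) (adj_sym _ b v) va vb /=; lia.
Qed.

Let cardT : #|T| = 3 + \sum_(w | W w) 1.
Proof. by rewrite -sum1_card (sum_split3 (fun=> 1)). Qed.

(* Here a and b are nonadjacent, so every vertex other than v and a is
   connected to b by a path avoiding v and a. *)
Lemma degree_two_dominated :
  (forall w, W w -> adj G w a) -> 4 * #|T| <= \sum_x deg x + 10.
Proof.
move=> Wa.
(* The nonneighbour of [a] given by [nodom] is neither [v] nor in [W], so it is [b]. *)
have ab : ~~ adj G a b.
  have [w wa aw] := nodom a; suff <- : w = b by [].
  apply/eqP; apply: contraNT aw => wb; have [->|wv] := eqVneq w v.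
    by rewrite adj_sym va.
  by rewrite adj_sym Wa // /W wv wa.
pose V w := (w != v) && (w != a).
pose e x y := [&& V x, V y & adj G x y].
have eS : symmetric e by move=> x y; rewrite /e adj_sym andbCA.
have Vb : V b by rewrite /V !(eq_sym b) nab (adj_neq vb).
have cS x : x \in [set x | V x] -> connect e b x.
  rewrite inE => Vx; have [->|xb] := eqVneq x b; first exact: connect0.
  have [bx|bx] := boolP (adj G b x); first by apply: connect1; rewrite /e Vb Vx.
  have [|z bz xz] := diam2 _ bx; first by rewrite eq_sym.
  case/andP: (Vx) => xv xa.
  have Vz : V z.
    apply/andP; split; apply/eqP => ez; subst z.
      by rewrite adj_sym NvE (negPf xa) (negPf xb) in xz.
    by rewrite adj_sym (negPf ab) in bz.
  apply: (@connect_trans _ _ z); apply: connect1; rewrite /e ?Vb ?Vz ?Vx //=.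
  by rewrite adj_sym.
have := connect_sum_ge eS cS.
have Vv : V v = false by rewrite /V eqxx.
have Va : V a = false by rewrite /V eqxx andbF.
have WV w : W w -> V w by case/and3P => wv wa _; rewrite /V wv wa.
have ein x : \sum_y e x y = V x * (adj G x b + \sum_(z | W z) adj G x z).
  rewrite sum_split3 /e Vv Va Vb; case: (V x) => /=; last by rewrite big1.
  by rewrite mul1n; congr (_ + _); apply: eq_bigr => w /WV ->.
have -> : \sum_x \sum_y e x y = 2 * s b + E.
  under eq_bigr do rewrite ein.
  rewrite sum_split3 Vb Va Vv !mul0n !add0n adj_irr mul1n add0n s_sym.
  rewrite (eq_bigr (fun w => adj G w b + \sum_(z | W z) adj G w z)); last first.
    by move=> w /WV ->; rewrite mul1n.
  by rewrite big_split /= -/(s b) -/E; lia.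
have : s a = \sum_(w | W w) 1 by apply: eq_bigr => w /Wa ->.
have -> : #|[set x | V x]| = 1 + \sum_(w | W w) 1.
  rewrite -sum_nat_bool sum_split3 Vb Va Vv.
  by congr (_ + _); apply: eq_bigr => w /WV ->.
(* Here [s a] is the size of [W], and connectedness gives 2|W| <= 2 s(b) + E, so the degree sum is
   at least 4 + 4|W| = 4|T| - 8. *)
have := sum_degree_ge; rewrite cardT; lia.
Qed.

Let Edge x y := [&& W x, W y & adj G x y].

(* The vertices of W adjacent to only one of a and b lie in one component of W. *)
Lemma degree_two_mixed x0 y0 : W x0 -> ~~ adj G x0 b -> W y0 -> ~~ adj G y0 a ->
  4 * #|T| <= \sum_x deg x + 10.
Proof.
move=> Wx0 x0b Wy0 y0a.
have eS : symmetric Edge by move=> x y; rewrite /Edge adj_sym andbCA.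
have joined x y : W x -> ~~ adj G x b -> W y -> ~~ adj G y a -> connect Edge x y.
  move=> Wx xb Wy ya; have [->|nxy] := eqVneq x y; first exact: connect0.
  have [xy|xy] := boolP (adj G x y); first by apply: connect1; rewrite /Edge Wx Wy.
  have [z xz yz] := diam2 nxy xy.
  have Wz : W z.
    case/and3P: Wx => xv xa xb'; apply/and3P; split; apply/eqP => ez; subst z.
    - by rewrite adj_sym NvE (negPf xa) (negPf xb') in xz.
    - by rewrite yz in ya.
    - by rewrite xz in xb.
  by apply: (@connect_trans _ _ z); apply: connect1;
     rewrite /Edge ?Wx ?Wy ?Wz //= adj_sym.
pose S := [set x | W x && (~~ adj G x a || ~~ adj G x b)].
have cS x : x \in S -> connect Edge x0 x.
  rewrite inE => /andP[Wx /orP[xa|xb]]; first exact: joined.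
  apply: (connect_trans (joined _ _ Wx0 x0b Wy0 y0a)).
  by rewrite (sym_connect_sym eS) joined.
have := connect_sum_ge eS cS.
have -> : \sum_x \sum_y Edge x y = E.
  rewrite /E [RHS]big_mkcond; apply: eq_bigr => x _; rewrite /Edge.
  case: (W x) => /=; last by rewrite big1.
  by rewrite [RHS]big_mkcond; apply: eq_bigr => y _; case: (W y).
have eS' : #|S| = \sum_(w | W w) (~~ adj G w a || ~~ adj G w b).
  by rewrite -sum_nat_bool [RHS]big_mkcond; apply: eq_bigr => w _; case: (W w).
(* A vertex adjacent to both [a] and [b] counts twice in [s a + s b]; one adjacent to a single one
   counts once there and once in [S]. *)
have : 2 * \sum_(w | W w) 1 = s a + s b + #|S|.
  rewrite eS' -!big_split big_distrr /=; apply: eq_bigr => w /W_adj.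
  by case: (adj G w a); case: (adj G w b).
(* With 2|S| <= E + 2 the degree sum is at least 2 + 4|W| = 4|T| - 10, which uses up the whole
   constant 10. *)
have := sum_degree_ge; rewrite cardT; lia.
Qed.

End DegreeTwo.

(** By the minimum degree d. For d >= 4 the degree sum suffices. For d = 0 a nonneighbour shares no
    neighbour with [v], and for d = 1 the only neighbour would dominate. For d = 2 the two preceding
    lemmas apply. For d = 3 every nonneighbour of [v] has a neighbour among the three neighbours of
    [v], so with W the set of nonneighbours the degree sum is at least 3 + (3 + |W|) + 3|W| = 4|T| -
    10. *)
Lemma diam2_card_edges : 0 < #|T| -> 2 * #|T| <= #|edges G| + 5.
Proof.
case/card_gt0P => t _; suff: 4 * #|T| <= \sum_x deg x + 10 by rewrite handshake; lia.
pose v := [arg min_(x < t) deg x].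
have vmin x : deg v <= deg x by rewrite /v; case: arg_minnP => // y _; apply.
have degN x : deg x = #|[set y | adj G x y]| by rewrite sum_nat_bool.
have sum_ge : #|T| * deg v <= \sum_x deg x.
  by rewrite -sum_nat_const; apply: leq_sum.
have far w : w != v -> ~~ adj G v w -> exists2 z, adj G v z & adj G w z.
  by move=> wv; apply: diam2; rewrite eq_sym.
move Ed : (deg v) sum_ge => d; case: d Ed => [|[|[|[|d]]]] Ed sum_ge; last by lia.
- have [w wv vw] := nodom v; have [z vz _] := far _ wv vw.
  by move: Ed; rewrite (bigD1 z) //= vz.
- have /eqP/cards1P[a Na] : #|[set y | adj G v y]| = 1 by rewrite -degN.
  have NvE y : adj G v y = (y == a) by have := in_set1 y a; rewrite -Na inE.
  have [w wa aw] := nodom a; have [wv|wv] := eqVneq w v.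
    by move: aw; rewrite wv adj_sym NvE eqxx.
  have [|z] := far _ wv; first by rewrite NvE.
  by rewrite NvE => /eqP ->; rewrite adj_sym (negPf aw).
- have /eqP/cards2P[a [b [nab Na]]] : #|[set y | adj G v y]| = 2 by rewrite -degN.
  have NvE y : adj G v y = (y == a) || (y == b).
    by have := in_set2 y a b; rewrite -Na inE.
  have NvE' y : adj G v y = (y == b) || (y == a) by rewrite NvE orbC.
  pose W w := [&& w != v, w != a & w != b].
  have [/existsP[y0 /andP[Wy ya]]|/existsPn Wa] := boolP [exists w, W w && ~~ adj G w a].
    have [/existsP[x0 /andP[Wx xb]]|/existsPn Wb] := boolP [exists w, W w && ~~ adj G w b].
      exact: (degree_two_mixed nab NvE Wx xb Wy ya).
    apply: (degree_two_dominated _ NvE'); first by rewrite eq_sym.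
    by move=> w Ww; move: (Wb w); rewrite /W !(andbC (w != a)) Ww negbK.
  apply: (degree_two_dominated nab NvE) => w Ww.
  by move: (Wa w); rewrite /W Ww negbK.
- have N3 : \sum_y adj G v y = 3 by [].
  pose W w := (w != v) && ~~ adj G v w.
  have spl (f : T -> nat) : \sum_x f x =
      f v + \sum_(x | adj G v x) f x + \sum_(x | W x) f x.
    rewrite (bigD1 v) //= (bigID (adj G v)) /= addnA; congr (_ + _ + _).
    by apply: eq_bigl => x; apply: andb_idl => /adj_neq; rewrite eq_sym.
  have s1 : \sum_(x | adj G v x) 1 = 3.
    by rewrite -N3 [LHS]big_mkcond; apply: eq_bigr => x _; case: (adj G v x).
  have cardT : #|T| = 1 + 3 + \sum_(x | W x) 1.
    by rewrite -sum1_card (spl (fun=> 1)) s1.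
  have WW : 3 * \sum_(x | W x) 1 <= \sum_(x | W x) deg x.
    by rewrite big_distrr /=; apply: leq_sum => x _; rewrite muln1 -Ed.
  have NN : 3 + \sum_(x | W x) 1 <= \sum_(x | adj G v x) deg x.
    apply: (@leq_trans (\sum_(x | adj G v x) (1 + \sum_(w | W w) adj G x w))).
      rewrite big_split /= s1 leq_add2l exchange_big /=; apply: leq_sum => w /andP[wv vw].
      by have [z vz wz] := far _ wv vw; rewrite (bigD1 z) //= adj_sym wz.
    apply: leq_sum => x vx; rewrite (spl (fun y => nat_of_bool (adj G x y))).
    by rewrite (adj_sym _ x v) vx -addnA leq_add2l leq_addl.
  rewrite (spl (fun x => deg x)) Ed; lia.
Qed.

End DiameterTwo.

(** * Forests saturated for a path *)

(** Lists are permutations of each other when every predicate counts alike in both, which is linear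
    arithmetic in the counts of their pieces. *)
Ltac perm_count :=
  apply/seq.permP => P; rewrite /= -?cats1 !(map_cat, count_cat) /= ?(map_cat, count_cat) /=;
  repeat match goal with |- context [?t] =>
    lazymatch t with nat_of_bool _ => idtac | count _ _ => idtac end;
    generalize t; intro
  end; clear; lia.

Section Paths.
Variables (T : finType) (e : rel T).

Definition path_free k := forall t, sorted e t -> uniq t -> size t < k.

(* Joining u to v creates a path on at least k vertices through the new edge,
   with both ends in L. *)
Definition linked (L : pred T) u v k := exists p q,
  [/\ path e u p, path e v q, uniq ((u :: p) ++ v :: q),
      L (last u p) && L (last v q) & k <= size p + size q + 2].

Lemma linked_sym (L : pred T) u v k : linked L u v k -> linked L v u k.
Proof.
case=> p [q [up vq uq Lpq kpq]]; exists q, p; split=> //.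
- by rewrite uniq_catC.
- by rewrite andbC.
- by rewrite (addnC (size q)).
Qed.

Lemma linked_sub (L L' : pred T) u v k k' : k' <= k -> (forall x, L x -> L' x) ->
  linked L u v k -> linked L' u v k'.
Proof.
move=> kk LL [p [q [up vq uq /andP[Lp Lq] kpq]]]; exists p, q; split=> //.
  by rewrite !LL.
exact: leq_trans kpq.
Qed.

End Paths.

Section ParentMaps.
Variables (T : finType) (par : T -> option T).

Definition padj : rel T := fun x y => (par x == Some y) || (par y == Some x).

(** An upper bound for the number of edges, since each edge is recorded at one of its ends; the
    surplus of vertices over it is the number of roots. *)
Definition nonroots := \sum_x isSome (par x).

Lemma padj_sym : symmetric padj.
Proof. by move=> x y; rewrite /padj orbC. Qed.

(* The forest given by the parent map is saturated for the path on k.+1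
   vertices, and remains so, with k.+2 for k, after hanging three leaves on
   every vertex of L. *)
Record leafy (L : pred T) k : Prop := Leafy {
  leafy_free : path_free padj k.+1;
  leafy_nonadj u v : u != v -> ~~ padj u v -> linked padj L u v k.+1;
  leafy_adj x y : L x -> padj x y -> linked padj L x y k;
  leafy_from x : L x -> exists p,
    [/\ path padj x p, uniq (x :: p), L (last x p) & k <= size (x :: p)] }.

End ParentMaps.

(** * Hanging a layer of leaves on a forest *)

Section AddLeaves.
Variables (T : finType) (par : T -> option T) (L : pred T) (k : nat).
Variables (W : finType) (f : W -> T).
Hypotheses (k_gt0 : 0 < k) (ok : leafy par L k) (fL : forall w, L (f w)).
Hypothesis fiber : forall x, L x -> 2 < #|[set w | f w == x]|.

Definition leaf_par (u : T + W) : option (T + W) :=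
  match u with inl x => omap inl (par x) | inr w => Some (inl (f w)) end.

Definition is_leaf (u : T + W) := if u is inr _ then true else false.

Notation e := (padj par).
Notation e' := (padj leaf_par).

Lemma leaf_adj_ll x y : e' (inl x) (inl y) = e x y.
Proof. by rewrite /padj /=; case: (par x) => [a|]; case: (par y) => [b|]. Qed.

Lemma leaf_adj_rl w y : e' (inr w) (inl y) = (f w == y).
Proof. by rewrite /padj /=; case: (par y) => [b|]; rewrite orbF. Qed.

Lemma leaf_adj_lr w y : e' (inl y) (inr w) = (f w == y).
Proof. by rewrite padj_sym leaf_adj_rl. Qed.

Lemma leaf_adj_rr w w' : e' (inr w) (inr w') = false.
Proof. by []. Qed.

(** This is why three leaves are hung on each vertex: when two leaves with the same foot are joined,
    the path through them may have to end in a third one. *)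
Lemma fresh_leaf x a b : L x -> exists w, [/\ f w = x, w != a & w != b].
Proof.
move/fiber => gt2; have : ~~ ([set w | f w == x] \subset [set a; b]).
  apply: contraL gt2 => /subset_leq_card; rewrite cards2; case: (a != b); lia.
case/subsetPn => w; rewrite !inE negb_or => /eqP fw /andP[wa wb].
by exists w.
Qed.

Lemma path_inl u p : path e' (inl u) (map inl p) = path e u p.
Proof. by rewrite path_map; apply: eq_path => x y; rewrite /= leaf_adj_ll. Qed.

Lemma extend_path u p w : path e u p -> f w = last u p ->
  path e' (inl u) (rcons (map inl p) (inr w)).
Proof. by move=> up fw; rewrite rcons_path path_inl up last_map leaf_adj_lr fw /=. Qed.

Let inlI : injective (@inl T W). Proof. by move=> x y []. Qed.

(** Both ends lie in [L], so each can be prolonged by a leaf. The leaves [a] and [b] are kept free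
    because they may be ends of the edge being added. *)
Lemma extend_linked u v s a b : linked e L u v s -> exists p q,
  [/\ path e' (inl u) p, path e' (inl v) q,
      uniq (inr a :: (inl u :: p) ++ inl v :: q) /\
      uniq (inr b :: (inl u :: p) ++ inl v :: q),
      is_leaf (last (inl u) p) && is_leaf (last (inl v) q)
    & s <= size p + size q].
Proof.
case=> p [q [up vq uq /andP[Lp Lq] spq]].
have [w1 [fw1 w1a w1b]] := fresh_leaf a b Lp.
have [w2 [fw2 w2a w2b]] := fresh_leaf a b Lq.
exists (rcons (map inl p) (inr w1)), (rcons (map inl q) (inr w2)).
have w12 : w1 != w2.
  apply/eqP => ew; move: uq; rewrite cat_uniq => /and3P[_ /hasPn/(_ (last v q)) H _].
  by move: H; rewrite mem_last -fw2 -ew fw1 /mem /= -/(_ \in _ :: _) mem_last => /(_ isT).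
split; try exact: extend_path.
- suff H c : c != w1 -> c != w2 -> uniq (inr c :: (inl u :: rcons (map inl p) (inr w1)) ++
     inl v :: rcons (map inl q) (inr w2)) by split; apply: H; rewrite eq_sym.
  move=> c1 c2; rewrite (perm_uniq (s2 := [:: inr c; inr w1; inr w2] ++
    map inl ((u :: p) ++ v :: q))); last first.
    by perm_count.
  rewrite cat_uniq (map_inj_uniq inlI) uq andbT /=.
  apply/andP; split.
    have iE (x y : W) : (inr x == inr y :> T + W) = (x == y) by [].
    by rewrite !inE !iE negb_or c1 c2 w12.
  by apply/hasPn => _ /mapP[x _ ->].
- by rewrite !last_rcons.
- by rewrite !size_rcons !size_map; lia.
Qed.

Lemma extend_from x a b : L x -> exists p,
  [/\ path e' (inl x) p, uniq (inr a :: inl x :: p) /\ uniq (inr b :: inl x :: p),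
      is_leaf (last (inl x) p) & k <= size p].
Proof.
case/(leafy_from ok) => p [xp ux Lp kp].
have [w [fw wa wb]] := fresh_leaf a b Lp.
exists (rcons (map inl p) (inr w)); split.
- exact: extend_path.
- suff H c : w != c -> uniq (inr c :: inl x :: rcons (map inl p) (inr w)).
    by split; apply: H.
  move=> wc; rewrite (perm_uniq (s2 := [:: inr c; inr w] ++ map inl (x :: p))); last first.
    by perm_count.
  rewrite cat_uniq (map_inj_uniq inlI) ux andbT /=.
  apply/andP; split.
    have iE (y z : W) : (inr y == inr z :> T + W) = (y == z) by [].
    by rewrite !inE !iE eq_sym wc.
  by apply/hasPn => _ /mapP[y _ ->].
- by rewrite last_rcons.
- by rewrite size_rcons size_map.
Qed.

(** A leaf has a single neighbour, hence is never interior to a path; cutting off both ends leaves a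
    path of the old forest, with at most [k] vertices. *)
Lemma leaf_free : path_free e' k.+3.
Proof.
case=> [|a t] //; case/lastP: t => [|m z] //= amz uamz; rewrite size_rcons !ltnS.
have [m0 em] : exists m0, m = map inl m0.
  have : all (fun u => ~~ is_leaf u) m.
    apply/allP => -[//|w] wm; case/splitPr: wm amz uamz => m1 m2.
    rewrite rcons_cat cat_path /= => /and3P[_ e1 e2].
    move=> U; have {U} : uniq ((a :: m1) ++ inr w :: rcons m2 z) by [].
    rewrite cat_uniq => /and3P[_ /hasPn nh _].
    have lw : last a m1 = inl (f w).
      by case: (last a m1) e1 => // x; rewrite leaf_adj_lr => /eqP ->.
    have hw : inl (f w) \in rcons m2 z.
      move: e2; rewrite headI; case: (head z m2) => y //=.
      by rewrite leaf_adj_rl => /andP[/eqP -> _]; rewrite mem_head.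
    have := nh (inl (f w)); rewrite inE hw orbT => /(_ isT).
    by rewrite -lw /mem /= -/(_ \in _ :: _) mem_last.
  elim: m {amz uamz} => [|[x|w] m IH] //=; first by exists [::].
  by case/IH => m0 ->; exists (x :: m0).
have sm : sorted e m0.
  move/path_sorted: amz; rewrite -cats1 => /cat_sorted2[sm _]; move: sm.
  by rewrite em; case: (m0) => //= x m1; rewrite path_inl.
have um : uniq m0.
  by move: uamz; rewrite rcons_uniq => /and3P[_ _]; rewrite em (map_inj_uniq inlI).
have := leafy_free ok sm um; rewrite em size_map; lia.
Qed.

Lemma linked_any x y : L x -> x != y -> linked e L x y k.
Proof.
move=> Lx xy; have [exy|nxy] := boolP (e x y); first exact: (leafy_adj ok).
by apply: linked_sub (leafy_nonadj ok xy nxy).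
Qed.

(** The two end leaves add two vertices to a path. For two old vertices [leafy_nonadj] supplies
    [k.+1]; if a new leaf is joined, it adds one more vertex, so [k] is enough and the feet may even
    be adjacent. Two leaves with a common foot use [leafy_from]. *)
Lemma leaf_nonadj u v : u != v -> ~~ e' u v -> linked e' is_leaf u v k.+3.
Proof.
have half y w : ~~ e' (inl y) (inr w) -> linked e' is_leaf (inl y) (inr w) k.+3.
  rewrite leaf_adj_lr => fwy.
  have [p [q [p1 q1 [u1 _] /andP[l1 l2] s1]]] := extend_linked w w (linked_any (fL w) fwy).
  exists q, (inl (f w) :: p); split => //.
  - by rewrite /= leaf_adj_rl eqxx.
  - rewrite (perm_uniq (s2 := inr w :: (inl (f w) :: p) ++ inl y :: q)) //.
    by perm_count.
  - by rewrite l1 l2.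
  - by rewrite /= addn2 !addnS !ltnS addnC.
case: u v => [x|w] [y|w'].
- rewrite leaf_adj_ll => nxy /(leafy_nonadj ok nxy) lxy.
  have [w0 _] : exists w0 : W, True.
    have [p [q [_ _ _ /andP[Lx _] _]]] := lxy.
    have /ltnW/ltnW/card_gt0P[w0 _] := fiber Lx; by exists w0.
  have [p [q [p1 q1 [u1 _] l1 s1]]] := extend_linked w0 w0 lxy.
  exists p, q; split => //; last by lia.
  by case/andP: u1.
- by move=> _; apply: half.
- by move=> _ nwy; apply/linked_sym/half; rewrite padj_sym.
- move=> nww _; have [eff|nff] := eqVneq (f w) (f w').
    have [p [p1 [u1 u2] l1 s1]] := extend_from w w' (fL w).
    exists (inl (f w) :: p), [::]; split => //.
    + by rewrite /= leaf_adj_rl eqxx.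
    + rewrite (perm_uniq (s2 := inr w' :: inr w :: inl (f w) :: p)); last by perm_count.
      rewrite cons_uniq u1 andbT; move: u2 => /andP[u2 _].
      by rewrite inE negb_or u2 andbT eq_sym.
    + by rewrite /= in l1 *; rewrite l1.
    + by rewrite /= addn0 addn2 !ltnS.
  have [p [q [p1 q1 [u1 u2] l1 s1]]] := extend_linked w w' (linked_any (fL w) nff).
  exists (inl (f w) :: p), (inl (f w') :: q); split => //.
  + by rewrite /= leaf_adj_rl eqxx.
  + by rewrite /= leaf_adj_rl eqxx.
  + rewrite (perm_uniq (s2 := inr w' :: inr w :: (inl (f w) :: p) ++ inl (f w') :: q)).
      rewrite cons_uniq u1 andbT; move: u2 => /andP[u2 _].
      by rewrite inE negb_or u2 andbT eq_sym.
    by perm_count.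
  + by rewrite /= addn2 addnS addSn !ltnS leqW.
Qed.

Lemma leafy_leaves : leafy leaf_par is_leaf k.+2.
Proof.
split.
- exact: leaf_free.
- exact: leaf_nonadj.
- move=> [//|w] [y|w'] _; rewrite ?leaf_adj_rr // leaf_adj_rl => /eqP <-.
  have [p [p1 [u1 _] l1 s1]] := extend_from w w (fL w).
  by exists [::], p; split => //; rewrite add0n addn2.
- move=> [//|w] _; have [p [p1 [u1 _] l1 s1]] := extend_from w w (fL w).
  by exists (inl (f w) :: p); split => //=; rewrite leaf_adj_rl eqxx.
Qed.

Lemma nonroots_leaves : nonroots leaf_par = nonroots par + #|W|.
Proof.
rewrite /nonroots big_sumType /=; congr (_ + _); last exact: sum1_card.
by apply: eq_bigr => x _; case: (par x).
Qed.

End AddLeaves.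

(** * Matchings and edgeless graphs, the bottom layers *)

Section Matching.
Variables h r : nat.

Definition match_par (u : 'I_h * bool + 'I_r) : option ('I_h * bool + 'I_r) :=
  if u is inl (i, true) then Some (inl (i, false)) else None.

Notation e := (padj match_par).

Lemma match_adj u v : e u v =
  match u, v with inl (i, b), inl (j, b') => (i == j) && (b != b') | _, _ => false end.
Proof.
have E (i j : 'I_h) b b' :
   (Some (inl (i, b)) == Some (inl (j, b')) :> option ('I_h * bool + 'I_r)) =
   (i == j) && (b == b') by [].
case: u v => [[i []]|x] [[j []]|y]; rewrite /padj /= ?E ?eqxx ?orbF ?andbT ?andbF //=.
Qed.

Lemma matching_free : path_free e 3.
Proof.
move=> [|u [|v [|w t]]] //=; rewrite !match_adj.
case: u v w => [[i b]|x] [[j b']|y] [[l b'']|z] //; rewrite ?andbF //.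
case/and3P => /andP[/eqP <- nb] /andP[/eqP <- nb'] _.
have -> : b'' = b by case: b b' b'' nb nb' => [] [] [].
by rewrite !inE eqxx orbT.
Qed.

Lemma matching_linked u v : r <= 1 -> u != v -> ~~ e u v -> linked e predT u v 3.
Proof.
move=> r1.
have half i b w : inl (i, b) != w -> ~~ e (inl (i, b)) w -> linked e predT (inl (i, b)) w 3.
  move=> nuw ew; have ep : e (inl (i, b)) (inl (i, ~~ b)).
    by rewrite match_adj eqxx; case: (b).
  exists [:: inl (i, ~~ b)], [::]; split => //; first by rewrite /= ep.
  rewrite /= !inE negb_or nuw andbT.
  have -> /= : inl (i, b) != inl (i, ~~ b) :> 'I_h * bool + 'I_r.
    by apply/eqP => -[]; case: (b).
  by rewrite andbT; apply: contra ew => /eqP <-.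
case: u v => [[i b]|x] [[j b']|y]; try exact: half.
  by move=> nuv euv; apply/linked_sym/half; rewrite 1?eq_sym // padj_sym.
have -> : x = y by apply: ord_inj; case: x y => [x xr] [y yr] /=; lia.
by rewrite eqxx.
Qed.

Lemma nonroots_matching : nonroots match_par = h.
Proof.
rewrite /nonroots big_sumType /= [X in _ + X]big1 ?addn0 //.
rewrite (eq_bigr (fun p : 'I_h * bool => nat_of_bool p.2)); last by case=> i [].
rewrite -(pair_bigA _ (fun _ (b : bool) => nat_of_bool b)) /=.
under eq_bigr do rewrite big_bool /=.
by rewrite sum1_card card_ord.
Qed.

Lemma card_matching : #|{: 'I_h * bool + 'I_r}| = h.*2 + r.
Proof. by rewrite card_sum card_prod !card_ord card_bool muln2. Qed.

End Matching.

(** The matching is perfect because [leafy_from] asks for a path on two vertices from every vertex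
    of [L]. *)
Lemma leafy_matching h : leafy (@match_par h 0) predT 2.
Proof.
split.
- exact: matching_free.
- by move=> u v nuv euv; apply: matching_linked.
- move=> x y _ exy; exists [::], [::]; split=> //=.
  rewrite inE andbT; apply: contraTneq exy => ->.
  by rewrite match_adj; case: y => [[i b]|] //; rewrite !eqxx.
- move=> [[i b]|[]//] _; exists [:: inl (i, ~~ b)]; split => //=.
    by rewrite match_adj eqxx; case: b.
  by rewrite andbT inE; apply/eqP => -[]; case: b.
Qed.

Definition no_parent (T : finType) (x : T) : option T := None.

Lemma leafy_isolated (T : finType) : leafy (@no_parent T) predT 1.
Proof.
split=> //.
- by case=> [|a [|b t]].
- move=> u v nuv _; exists [::], [::]; split => //=.
  by rewrite inE nuv.
- by move=> x _; exists [::].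
Qed.

Lemma nonroots_isolated (T : finType) : nonroots (@no_parent T) = 0.
Proof. exact: big1. Qed.

Section ThreeLeaves.
Variables (T : finType) (L : pred T) (r : nat) (x0 : {x : T | L x}).

(* The r extra leaves on x0 serve to reach every large number of vertices. *)
Definition leaf_foot (w : {x : T | L x} * 'I_3 + 'I_r) : T :=
  match w with inl p => val p.1 | inr _ => val x0 end.

Lemma leaf_footP w : L (leaf_foot w).
Proof. by case: w => [[x i]|i] /=; apply: valP. Qed.

Lemma leaf_foot_fiber x : L x -> 2 < #|[set w | leaf_foot w == x]|.
Proof.
move=> Lx; pose g (i : 'I_3) : {x : T | L x} * 'I_3 + 'I_r := inl (Sub x Lx, i).
have gI : injective g by move=> i j [].
have g3 : 3 <= #|[set g i | i : 'I_3]| by rewrite card_imset ?card_ord.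
apply: leq_trans g3 _.
by apply/subset_leq_card/subsetP => _ /imsetP[i _ ->]; rewrite inE /=.
Qed.

Lemma card_leaf_foot : #|{: {x : T | L x} * 'I_3 + 'I_r}| = #|{: {x : T | L x}}| * 3 + r.
Proof. by rewrite card_sum card_prod !card_ord. Qed.

End ThreeLeaves.

Definition leafy_forest c k := exists (T : finType) (par : T -> option T) (L : pred T),
  [/\ leafy par L k, nonroots par + c <= #|T| & exists x, L x].

(** Every new leaf has a parent, so the number of roots, which [c] bounds from below, is
    unchanged. *)
Lemma leafy_forest_step c k : 0 < k -> leafy_forest c k -> leafy_forest c k.+2.
Proof.
move=> k0 [T [par [L [ok le [x Lx]]]]]; pose x0 : {x | L x} := Sub x Lx.
exists (T + ({x : T | L x} * 'I_3 + 'I_0))%type, (leaf_par par (leaf_foot x0)), (@is_leaf _ _).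
split.
- exact: (leafy_leaves k0 ok (leaf_footP x0 (r := 0)) (@leaf_foot_fiber _ _ _ _)).
- by rewrite nonroots_leaves [leqRHS]card_sum addnAC leq_add2r.
- by exists (inr (inl (x0, ord0))).
Qed.

(** A layer raises [k] by two, so the induction carries two consecutive values; it starts from [c]
    isolated vertices and [c] disjoint edges. *)
Lemma leafy_exists c k : 0 < c -> 0 < k -> leafy_forest c k.
Proof.
move=> c0; suff H k' : 0 < k' -> forall j, (j == k') || (j == k'.+1) -> 0 < j -> leafy_forest c j.
  by move=> k0; apply: (H k k0) => //; rewrite eqxx.
elim: k' => // -[|k'] IH _ j.
  case/orP => /eqP -> _.
    exists 'I_c, (@no_parent _), predT; split; first exact: leafy_isolated.
      by rewrite nonroots_isolated card_ord.
    by exists (Ordinal c0).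
  exists ('I_c * bool + 'I_0)%type, (@match_par c 0), predT.
  split; first exact: leafy_matching.
    by rewrite nonroots_matching card_matching addn0 addnn.
  by exists (inl (Ordinal c0, true)).
case/orP => /eqP -> _; first by apply: IH; rewrite // eqxx orbT.
by apply: leafy_forest_step => //; apply: IH; rewrite // eqxx.
Qed.

(** For [k = 2] the graph is edgeless, for [k = 3] a matching missing at most one vertex; beyond
    that, surplus leaves in the last layer reach every large order. *)
Lemma path_saturated_forest c k : 1 < k -> exists M, forall m, M <= m ->
  exists (T : finType) (par : T -> option T),
  [/\ #|T| = m, path_free (padj par) k,
      forall u v, u != v -> ~~ padj par u v -> linked (padj par) predT u v k
    & nonroots par + c <= m].
Proof.
case: k => [|[|[|[|k]]]] // _.
- exists c => m cm; exists 'I_m, (@no_parent _).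
  rewrite nonroots_isolated card_ord.
  have [fr ln _ _] := leafy_isolated 'I_m; split => //.
- exists c.*2 => m cm; exists ('I_m./2 * bool + 'I_(odd m))%type, (@match_par m./2 (odd m)).
  rewrite card_matching nonroots_matching; split.
  + by rewrite addnC odd_double_half.
  + exact: matching_free.
  + by move=> u v; apply: matching_linked; case: (odd m).
  + by rewrite -[leqRHS]odd_double_half -addnn; have := half_leq cm; rewrite doubleK; lia.
(* [c.+1] makes the number of roots positive, as [leafy_exists] demands; one more layer turns [k.+1]
   into [k.+3], which forbids the path on [k.+4] vertices. *)
have [T [par [L [ok le [x Lx]]]]] : leafy_forest c.+1 k.+1 by exact: leafy_exists.
pose x0 : {x | L x} := Sub x Lx.
exists (#|T| + #|{: {x : T | L x}}| * 3) => m lem.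
pose r := m - (#|T| + #|{: {x : T | L x}}| * 3).
have [fr ln _ _] :=
  leafy_leaves (ltn0Sn k) ok (leaf_footP x0 (r := r)) (@leaf_foot_fiber _ _ _ _).
have cm : #|{: T + ({x : T | L x} * 'I_3 + 'I_r)}| = m.
  by rewrite card_sum card_leaf_foot /r; lia.
exists (T + ({x : T | L x} * 'I_3 + 'I_r))%type,
  (leaf_par par (leaf_foot x0)); split; [exact: cm | exact: fr | |].
  by move=> u v nuv euv; apply: linked_sub (ln _ _ nuv euv).
by rewrite -cm nonroots_leaves [leqRHS]card_sum addnAC leq_add2r; apply: leq_trans le; lia.
Qed.

(** * Saturated graphs for linear forests *)

(** Serves to embed the linear forest into the clique, which has one vertex too few, apart from a
    vertex [z] placed elsewhere. *)
Lemma almost_injection (U B : finType) (z : U) (b0 : B) : #|U| <= #|B|.+1 ->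
  exists g : U -> B, forall x y, x != z -> y != z -> g x = g y -> x = y.
Proof.
move=> leUB; pose s := enum [set~ z].
have ss : size s <= size (enum B).
  by rewrite /s -!cardE cardsC1; case: #|U| leUB.
exists (fun x => nth b0 (enum B) (index x s)) => x y xz yz /eqP.
have [xs ys] : x \in s /\ y \in s by rewrite !mem_enum !inE.
have lt w : w \in s -> index w s < size (enum B).
  by rewrite -index_mem => /leq_trans; apply.
by rewrite nth_uniq ?enum_uniq ?lt // => /eqP /index_inj; apply.
Qed.

Lemma almost_injection_at (U B : finType) (z a : U) (b : B) : #|U| <= #|B|.+1 ->
  exists2 g : U -> B, g a = b & forall x y, x != z -> y != z -> g x = g y -> x = y.
Proof.
move=> /(almost_injection z b)[g gI]; exists (fun x => tperm (g a) b (g x)).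
  exact: tpermL.
by move=> x y xz yz /perm_inj; apply: gI.
Qed.

Lemma isomorphic_ord (T : finType) (G : sgraph T) m : #|T| = m ->
  exists G' : sgraph 'I_m, isomorphic G G'.
Proof.
move=> <-; exists (graph_of (fun i j => adj G (enum_val i) (enum_val j))).
apply/isomorphicP; exists enum_rank, enum_val.
split; [exact: enum_rankK | exact: enum_valK | move=> x y].
rewrite adj_graph_of !enum_rankK (adj_sym _ y) orbb (inj_eq enum_rank_inj).
by symmetry; apply/andb_idl/adj_neq.
Qed.

Lemma contains_add_edgeC (U T : finType) (F : sgraph U) (G : sgraph T) u v :
  contains F (add_edge G u v) -> contains F (add_edge G v u).
Proof.
apply: contains_isor; apply/isomorphicP; exists id, id; split=> // x y.
by rewrite !adj_add_edge [X in _ || X]orbC.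
Qed.

Lemma sorted_join_paths (T : Type) (e e2 : rel T) x y p r : symmetric e ->
  (forall a b, e a b -> e2 a b) -> e2 x y -> path e x p -> path e y r ->
  sorted e2 (rev (x :: p) ++ y :: r).
Proof.
move=> eS ee exy xp yr; rewrite sorted_cat_cons -rev_cons rev_sorted /= exy.
apply/andP; split; last exact: sub_path yr.
by apply: sub_path xp => a b; rewrite eS; apply: ee.
Qed.

Section PathForest.
Variable s : seq nat.
Notation V := {i : 'I_(size s) & 'I_(nth 0 s i)}.
Notation vtx i j := (Tagged (fun i : 'I_(size s) => 'I_(nth 0 s i)) (j : 'I_(nth 0 s i)) : V).

Lemma adj_path_graph n (i j : 'I_n) : adj (path_graph n) i j = (i.+1 == j) || (j.+1 == i).
Proof.
rewrite adj_graph_of; apply: andb_idl; rewrite -(inj_eq val_inj) /=.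
by case/orP => /eqP <-; rewrite neq_ltn leqnn ?orbT.
Qed.

Lemma adj_path_forest (i : 'I_(size s)) (j j' : 'I_(nth 0 s i)) :
  adj (path_forest s) (vtx i j) (vtx i j') = (j.+1 == j') || (j'.+1 == j).
Proof.
rewrite adj_graph_of /= !eqxx /= !tagged_asE !adj_path_graph [X in _ || X]orbC orbb.
rewrite -tag_eqE /tag_eq /= eqxx tagged_asE.
apply: andb_idl; rewrite -(inj_eq val_inj) /=.
by case/orP => /eqP <-; rewrite neq_ltn leqnn ?orbT.
Qed.

Lemma adj_path_forest_tag u v : adj (path_forest s) u v -> tag u = tag v.
Proof.
by rewrite adj_graph_of => /andP[_ /orP[]/andP[/eqP]].
Qed.

Lemma contains_path_forest (T : finType) (G : sgraph T) (f : V -> T) : injective f ->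
  (forall (i : 'I_(size s)) (j j' : 'I_(nth 0 s i)),
    j.+1 = j' -> adj G (f (vtx i j)) (f (vtx i j'))) ->
  contains (path_forest s) G.
Proof.
move=> fI fA; apply/containsP; exists f => // -[i j] [i' j'] a.
have /= e := adj_path_forest_tag a; subst i'.
move: a; rewrite adj_path_forest => /orP[]/eqP; first exact: fA.
by rewrite adj_sym; apply: fA.
Qed.

(** * A clique beside a path-saturated forest *)

Section CliqueForest.
Variables (T : finType) (par : T -> option T) (i0 : 'I_(size s)).
Notation k := (nth 0 s i0).
Notation q := (#|{: V}|.-1).
Hypotheses (s2 : all (leq 2) s) (i0min : forall i : 'I_(size s), k <= nth 0 s i).
Hypotheses (free : path_free (padj par) k).
Hypothesis nonadj : forall u v, u != v -> ~~ padj par u v -> linked (padj par) predT u v k.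

Definition clique_forest : sgraph ('I_q + T)%type :=
  graph_of (fun u v : 'I_q + T => match u, v with
    | inl _, inl _ => true
    | inr x, inr y => par x == Some y
    | _, _ => false
    end).

Lemma adj_clique_forest u v : adj clique_forest u v = match u, v with
    | inl i, inl j => i != j
    | inr x, inr y => (x != y) && padj par x y
    | _, _ => false
    end.
Proof. by rewrite adj_graph_of; case: u v => [i|x] [j|y]; rewrite ?andbT ?andbF. Qed.

Lemma k_gt1 : 1 < k.
Proof. by apply: (allP s2); rewrite mem_nth. Qed.

Let z : V := vtx i0 (Ordinal (ltnW k_gt1)).
Let z1 : V := vtx i0 (Ordinal k_gt1).

Lemma z1z : z1 != z.
Proof. by rewrite -tag_eqE /tag_eq /= eqxx tagged_asE. Qed.

Lemma card_forest_gt1 : 1 < #|{: V}|.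
Proof.
have c2 : #|[set z1; z]| = 2 by rewrite cards2 z1z.
by have := max_card (mem [set z1; z]); rewrite c2.
Qed.

Lemma q_gt0 : 0 < q.
Proof. by have := card_forest_gt1; lia. Qed.

(** Each path, being connected, lies on one side; it has at least [k] vertices, too many for the
    forest, so all go to the clique, which is one vertex short. *)
Lemma clique_forest_free : ~~ contains (path_forest s) clique_forest.
Proof.
apply/containsP => -[f fI fA].
have inlf v : exists c, f v = inl c.
  case: v => i j; case Ej: (f _) => [c|x]; first by exists c.
  pose isl (u : 'I_q + T) := if u is inl _ then true else false.
  have const m (lm : m < nth 0 s i) (l0 : 0 < nth 0 s i) :
      isl (f (vtx i (Ordinal lm))) = isl (f (vtx i (Ordinal l0))).
    elim: m lm => [|m IH] lm; first by congr (isl (f (vtx i _))); apply: val_inj.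
    rewrite -(IH (ltnW lm)).
    have : adj (path_forest s) (vtx i (Ordinal (ltnW lm))) (vtx i (Ordinal lm)).
      by rewrite adj_path_forest /= eqxx.
    by move/fA; rewrite adj_clique_forest; do 2!case: (f _).
  have l0 : 0 < nth 0 s i by apply: leq_ltn_trans (ltn_ord j).
  have inrf (j' : 'I_(nth 0 s i)) :
      f (vtx i j') = inr (if f (vtx i j') is inr y then y else x).
    case E: (f (vtx i j')) => [c|//].
    case: j j' Ej E => j lj [j' lj'] Ej E.
    have := const _ lj l0; have := const _ lj' l0; by rewrite Ej E => <-.
  pose g j' := if f (vtx i j') is inr y then y else x.
  have gI : injective g.
    move=> a b eg; have /fI/eqP : f (vtx i a) = f (vtx i b).
      by rewrite (inrf a) (inrf b) -/(g a) eg.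
    by rewrite -tag_eqE /tag_eq /= eqxx tagged_asE => /eqP.
  have gS : sorted (padj par) (map g (enum 'I_(nth 0 s i))).
    have : sorted (fun a b => a.+1 == b) (map val (enum 'I_(nth 0 s i))).
      rewrite val_enum_ord; case: (nth 0 s i) => //= n; move: 0.
      by elim: n => //= n IH m; rewrite eqxx IH.
    rewrite !sorted_map; apply: sub_sorted => a b /= /eqP ab.
    have := fA (vtx i a) (vtx i b); rewrite adj_path_forest ab eqxx => /(_ isT).
    by rewrite (inrf a) (inrf b) adj_clique_forest => /andP[].
  have := free gS; rewrite map_inj_uniq // enum_uniq size_map size_enum_ord => /(_ isT).
  by rewrite ltnNge i0min.
pose g v := if f v is inl c then c else Ordinal q_gt0.
have gI : injective g.
  move=> u v; rewrite /g; have [c ec] := inlf u; have [d ed] := inlf v.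
  by rewrite ec ed => ecd; apply: fI; rewrite ec ed ecd.
by have := leq_card g gI; rewrite card_ord leqNgt ltn_predL (ltnW card_forest_gt1).
Qed.

(** For a new edge between clique and forest, the end [z] of the shortest path goes to the forest,
    its only neighbour [z1] to the clique end of the edge, and the rest into the clique. For a new
    edge inside the forest, the whole shortest path runs through that edge, and the other paths,
    which avoid [z], fit into the clique. *)
Lemma clique_forest_saturated : saturated (path_forest s) clique_forest.
Proof.
have leVq : #|{: V}| <= #|'I_q|.+1 by rewrite card_ord; lia.
apply/saturatedP; split; first exact: clique_forest_free.
have mixed c x : contains (path_forest s) (add_edge clique_forest (inl c) (inr x)).
  have [g gc gI] := almost_injection_at z z1 c leVq.
  apply: (@contains_path_forest _ _ (fun v => if v == z then inr x else inl (g v))).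
    move=> u v; case: eqP => [->|/eqP uz]; case: eqP => [->|/eqP vz] //.
    by case; apply: gI.
  move=> i j j' jj'.
  have j'z : vtx i j' != z.
    apply/eqP => /(congr1 (fun v : V => nat_of_ord (tagged v))) /=; lia.
  rewrite (negPf j'z); case: eqP => [ejz|/eqP jz].
    have -> : vtx i j' = z1.
      have := congr1 tag ejz => /= ei; subst i; congr (vtx _ _); apply: val_inj => /=.
      move: (congr1 (fun v : V => nat_of_ord (tagged v)) ejz) => /=; lia.
    by rewrite adj_add_edge gc !eqxx orbT.
  rewrite adj_add_edge adj_clique_forest.
  have -> : (inl (g (vtx i j)) != inl (g (vtx i j')) :> 'I_q + T) =
            (g (vtx i j) != g (vtx i j')) by [].
  rewrite andbC; have -> // : g (vtx i j) != g (vtx i j').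
  apply/eqP => /(gI _ _ jz j'z)/(congr1 (fun v : V => nat_of_ord (tagged v))) /=; lia.
move=> [c|x] [d|y]; rewrite adj_clique_forest.
- by move=> -> .
- by move=> _ _; apply: mixed.
- by move=> _ _; apply/contains_add_edgeC/mixed.
have -> : (inr x != inr y :> 'I_q + T) = (x != y) by [].
move=> nxy; rewrite nxy /= => /(nonadj nxy)[p [r [xp yr upr _ kpr]]].
pose e2 a b := padj par a b || (a == x) && (b == y).
pose t := rev (x :: p) ++ y :: r.
have ut : uniq t.
  by rewrite (perm_uniq (s2 := (x :: p) ++ y :: r)) // perm_cat2r perm_rev.
have st : sorted e2 t.
  apply: (sorted_join_paths (padj_sym par)) xp yr; rewrite /e2 ?eqxx ?orbT //.
  by move=> a b ->.
have kt : k <= size t by rewrite size_cat size_rev /=; lia.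
have [g gI] := almost_injection z (Ordinal q_gt0) leVq.
have tn (i : 'I_(size s)) (j : 'I_(nth 0 s i)) : i = i0 -> j < size t.
  by move=> ei; apply: leq_trans kt; rewrite -ei.
have nz (i : 'I_(size s)) j : i != i0 -> vtx i j != z.
  by apply: contraNneq => /(congr1 tag) /= ->.
apply: (@contains_path_forest _ _ (fun v =>
  if tag v == i0 then inr (nth x t (tagged v)) else inl (g v))).
  move=> [i j] [i' j'] /=; case: eqP => [ei|/eqP ni]; case: eqP => [ei'|/eqP ni'] //.
    case=> /eqP; rewrite nth_uniq ?tn // => /eqP ejj; subst i i'.
    by congr (vtx _ _); apply: val_inj.
  by case; apply: gI; apply: nz.
move=> i j j' jj' /=; case: (eqVneq i i0) => [ei|ni]; rewrite adj_add_edge.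
  have lt : j.+1 < size t by rewrite jj' tn.
  have := elimT (sortedP x) st _ lt; rewrite jj'.
  have ne : nth x t j != nth x t j' by rewrite nth_uniq ?tn // -jj' neq_ltn leqnn.
  rewrite adj_clique_forest.
  rewrite (_ : (inr _ != inr _ :> 'I_q + T) = (nth x t j != nth x t j')) //.
  by rewrite ne /= => /orP[->|/andP[/eqP -> /eqP ->]]; rewrite ?eqxx ?orbT.
rewrite adj_clique_forest.
rewrite (_ : (inl _ != inl _ :> 'I_q + T) = (g (vtx i j) != g (vtx i j'))) //.
rewrite andbC; have -> // : g (vtx i j) != g (vtx i j').
apply/eqP => /(gI _ _ (nz _ _ ni) (nz _ _ ni)).
by move=> /(congr1 (fun v : V => nat_of_ord (tagged v))) /=; lia.
Qed.

Lemma card_edges_clique_forest : #|edges clique_forest| <= q * q + nonroots par.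
Proof.
apply: leq_trans (card_edges_graph_of _) _; rewrite big_sumType /=; apply: leq_add.
  under eq_bigr do rewrite big_sumType /= sum1_card card_ord big1 // addn0.
  by rewrite sum_nat_const card_ord.
apply: leq_sum => x _; rewrite big_sumType /= big1 // add0n.
case: (par x) => [y|]; last by rewrite big1.
rewrite (bigD1 y) //= eqxx big1 // => y' /negPf ny.
by have -> : (Some y == Some y') = (y == y') by []; rewrite eq_sym ny.
Qed.

End CliqueForest.
End PathForest.

Lemma linear_forest_saturated (U : finType) (F : sgraph U) (u0 : U) :
  linear_forest_no_isolated F ->
  exists M, forall m, M <= m ->
    exists2 H : sgraph 'I_m, saturated F H & #|edges H| + 4 <= m.
Proof.
case=> s s2 isoF.
have [f _] := elimT (isomorphicP _ _) isoF; have i1 := tag (f u0).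
pose i0 := [arg min_(i < i1) nth 0 s i].
have i0min (i : 'I_(size s)) : nth 0 s i0 <= nth 0 s i.
  by rewrite /i0; case: arg_minnP => // i' _; apply.
pose q := #|{: {i : 'I_(size s) & 'I_(nth 0 s i)}}|.-1.
(* [q * q] roots pay for the edges of the clique, and 4 more give the required margin. *)
have [M HM] := path_saturated_forest (q * q + 4) (k_gt1 i0 s2).
exists (M + q) => m lem.
have [|T [par [cT fr ln le]]] := HM (m - q); first by lia.
have [H isoH] : exists H : sgraph 'I_m, isomorphic (clique_forest s par) H.
  by apply: isomorphic_ord; rewrite card_sum card_ord cT; rewrite -/q; lia.
exists H.
  rewrite (saturated_isol _ isoF); apply: saturated_isor isoH _.
  exact: clique_forest_saturated s2 i0min fr ln.
by rewrite -(card_edges_iso isoH); have := card_edges_clique_forest s par; rewrite -/q; lia.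
Qed.

Lemma no_isolated (U : finType) (F : sgraph U) :
  linear_forest_no_isolated F -> forall a, exists b, adj F a b.
Proof.
case=> s s2 /isomorphicP[f [g [fK gK fA]]] a.
suff [w aw] : exists w, adj (path_forest s) (f a) w by exists (g w); rewrite fA gK.
case: (f a) => i j.
have n2 : 1 < nth 0 s i by apply: (allP s2); rewrite mem_nth.
pose vtx := Tagged (fun i : 'I_(size s) => 'I_(nth 0 s i)) (i := i).
have [lt|ge] := ltnP j.+1 (nth 0 s i).
  by exists (vtx (Ordinal lt)); rewrite adj_path_forest /= eqxx.
have lt : j.-1 < nth 0 s i by apply: leq_ltn_trans (leq_pred _) (ltn_ord j).
exists (vtx (Ordinal lt)); rewrite adj_path_forest /=.
by rewrite prednK ?eqxx ?orbT // -ltnS (leq_trans n2).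
Qed.

(** * Minimum saturated graphs for the cone *)

Theorem theorem1p3 (U : finType) (F : sgraph U)
    (hF : linear_forest_no_isolated F) :
  exists N : nat, forall n : nat, N <= n ->
    (forall G : sgraph 'I_n, G \in Sat n (join 'K_1 F) ->
       #|edges G| = n.-1 + sat n.-1 F) /\
    Sat n (join 'K_1 F) =
      [set G : sgraph 'I_n |
        [exists H : sgraph 'I_n.-1,
          (H \in Sat n.-1 F) && isomorphic G (join 'K_1 H)]].
Proof.
(* If [F] has no vertices, it lies in every graph and its cone in every nonempty one; nothing is
   saturated and both sets are empty. *)
case: (pickP U) => [u0 _|U0]; last first.
  have cF (T : finType) (H : sgraph T) : contains F H.
    have nU (u : U) : False by have := U0 u.
    by apply/containsP; exists (fun u => False_rect T (nU u)) => u; case: (nU u).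
  have nF m (H : sgraph 'I_m) : saturated F H = false.
    by apply/negP => /saturatedP[]; rewrite cF.
  have nK m (G : sgraph 'I_m.+1) : saturated (join 'K_1 F) G = false.
    apply/negP => /saturatedP[/negP[]]; apply/containsP.
    exists (fun=> ord0) => [[x|x] [y|y]|[x|x] [y|y]]; rewrite ?ord1 ?adj_join ?adj_K1 //;
      by [have := U0 x | have := U0 y].
  exists 1 => -[//|n] _; split => [G|]; first by rewrite inE nK.
  apply/setP => G; rewrite !inE nK; symmetry; apply/existsP => -[H].
  by rewrite inE nF.
have [M HM] := linear_forest_saturated u0 hF.
exists (maxn M 4).+1 => -[//|m]; rewrite ltnS geq_max => /andP[Mm m4] /=.
have [H1 sH1 eH1] := HM m Mm; have le1 := sat_le sH1.
have [H0 sH0 eH0] := sat_attained sH1.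
have upper (H : sgraph 'I_m) : saturated F H -> exists2 G : sgraph 'I_m.+1,
    isomorphic (join 'K_1 H) G & saturated (join 'K_1 F) G.
  move=> sH; have [|G iG] := @isomorphic_ord _ (join 'K_1 H) m.+1.
    by rewrite card_sum !card_ord.
  by exists G => //; apply: saturated_isor iG _; rewrite saturated_cone.
have eC (H : sgraph 'I_m) (G : sgraph 'I_m.+1) :
    isomorphic G (join 'K_1 H) -> #|edges G| = m + #|edges H|.
  by move=> /card_edges_iso ->; rewrite card_edges_cone card_ord.
have [G0 /isomorphic_sym iG0 sG0] := upper _ sH0.
have min_cone (G : sgraph 'I_m.+1) : G \in Sat m.+1 (join 'K_1 F) ->
    exists2 H : sgraph 'I_m, isomorphic G (join 'K_1 H) & H \in Sat m F.
  case/SatP=> sG minG.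
  have leG : #|edges G| <= m + sat m F by have := minG _ sG0; rewrite (eC _ _ iG0) eH0.
  have [/forallP nodom|] := boolP [forall v, exists w, (w != v) && ~~ adj G v w].
    have : 2 * #|'I_m.+1| <= #|edges G| + 5.
      apply: diam2_card_edges; last by rewrite card_ord.
        exact: cone_saturated_diam2 (no_isolated hF) sG.
      by move=> v; have /existsP[w /andP[]] := nodom v; exists w.
    (* Without a dominating vertex, 2m + 2 <= e(G) + 5 <= m + (m - 4) + 5 = 2m + 1. *)
    by rewrite card_ord; lia.
  rewrite negb_forall => /existsP[v /existsPn dom].
  have [|H /= iH] := @dominating_cone _ G v.
    by move=> w wv; have := dom w; rewrite wv negbK.
  exists H => //; have sH : saturated F H.
    by rewrite -saturated_cone; apply: saturated_isor iH sG.
  apply/SatP; split=> // H' /sat_le; move: leG; rewrite (eC _ _ iH); lia.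
have satE (H : sgraph 'I_m) : H \in Sat m F -> #|edges H| = sat m F.
  by rewrite inE => /andP[_ /eqP].
split=> [G /min_cone[H iH /satE <-]|]; first exact: eC.
apply/setP => G; apply/idP/idP => [/min_cone[H iH sH]|].
  by rewrite inE; apply/existsP; exists H; rewrite sH.
rewrite inE => /existsP[H /andP[sH iH]]; apply/SatP; split.
  apply: saturated_isor (isomorphic_sym iH) _; rewrite saturated_cone.
  by case/SatP: sH.
(* A minimum graph [G1] is itself a cone over a minimum F-saturated graph, so it has as many edges
   as [G]. *)
move=> G' sG'; have [G1 sG1 eG1] := sat_attained sG'.
have : G1 \in Sat m.+1 (join 'K_1 F) by rewrite inE sG1 eG1 /=.
case/min_cone => H' iH' /satE eH'; apply: leq_trans (sat_le sG').
by rewrite -eG1 (eC _ _ iH) (eC _ _ iH') eH' (satE _ sH).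
Qed.
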